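(* Let $\beta\in\mathrm{Br}_n^+$ be a positive braid word in which every braid generator $\sigma_1,\dots,\sigma_{n-1}$ appears. Let $C$ be the set of connected components of the braid closure $\overline{\beta}$, and let $C=C_1\sqcup C_2$ be a partition of $C$. Let $\{1,\dots,n\}=I_1\sqcup I_2$ be the partition given by $k\in I_j$ if the $k$-th strand of the braid belongs to a component in $C_j$, and let $T_{I_1,I_2}=\{(t_1,\dots,t_n)\in(\mathbb{C}^\times)^n: t_i=t_j \text{ whenever } i,j \text{ both belong to } I_1 \text{ or both belong to } I_2\}$. Then the set of elements of the double Bott–Samelson variety $\mathrm{BS}(\beta)$ that are stabilized by $T_{I_1,I_2}$ is isomorphic to $\mathrm{BS}(\beta_1)\times\mathrm{BS}(\beta_2)$, where $\beta_1\in\mathrm{Br}^+_{I_1}$ and $\beta_2\in\mathrm{Br}^+_{I_2}$ are the braid words obtained from $\beta$ by considering only the crossings between components belonging to $C_1$ and to $C_2$, respectively.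
   Context: $\mathrm{Br}_n^+$ is the positive braid monoid on $n$ strands with generators $\sigma_1,\dots,\sigma_{n-1}$. For $1\le i\le n-1$, $B_i(z)\in\mathrm{GL}_n(\mathbb{C}[z])$ is the identity matrix except for the $2\times2$ block $\begin{pmatrix} z&-1\\1&0\end{pmatrix}$ in rows and columns $i,i+1$. For a word $\beta=\sigma_{i_1}\cdots\sigma_{i_\ell}$, $B_\beta(z_1,\dots,z_\ell)=B_{i_1}(z_1)\cdots B_{i_\ell}(z_\ell)$. The double Bott–Samelson variety is $\mathrm{BS}(\beta)=\{(z_1,\dots,z_\ell)\in\mathbb{C}^\ell: \Delta_{[1,i],[1,i]}B_\beta(z_1,\dots,z_\ell)\ne0\text{ for all }i=1,\dots,n-1\}$, where $\Delta_{[1,i],[1,i]}$ is the leading principal $i\times i$ minor. (For one strand, or an empty word, it is a point.) Strands: draw $\beta$ from left to right on levels $1,\dots,n$, the letter $\sigma_i$ being a crossing of the strands at levels $i$ and $i+1$; the $p$-th strand is the one at level $p$ at the left end. The torus $(\mathbb{C}^\times)^n$ acts on $\mathrm{BS}(\beta)$ by multiplying $z_k$ by $t_p/t_q$, where $p$ (resp. $q$) is the strand at level $i_k$ (resp. $i_k+1$) just before the $k$-th crossing. The diagonal acts trivially. Connected components of the closure $\overline\beta$ correspond to orbits on $\{1,\dots,n\}$ of $\pi(\beta)=s_{i_1}\cdots s_{i_\ell}\in S_n$, $s_i=(i\ \,i+1)$. The braid $\beta_j$ is obtained from the diagram of $\beta$ by deleting all strands not indexed by $I_j$; it is a positive braid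 on $|I_j|$ strands. *)

(* Defs.v *)
From HB Require Import structures.
From mathcomp Require Import all_boot all_order all_fingroup all_algebra.
From mathcomp Require Import mpoly.
From mathcomp Require Import reals.
From mathcomp Require Import complex.

Set Implicit Arguments.
Unset Strict Implicit.
Unset Printing Implicit Defensive.

Import Order.TTheory GRing.Theory Num.Theory.
Local Open Scope ring_scope.

(* Everything is 0-based: strands and levels are elements of 'I_n, and the    *)
(* letter i : 'I_n.-1 is the generator usually written sigma_(i+1), which     *)
(* crosses the strands at levels i and i.+1.                                  *)
Definition braid_word (n : nat) := seq 'I_n.-1.

Fact lower_subproof (n : nat) (i : 'I_n.-1) : (i < n)%N.
Proof. by apply: leq_trans (ltn_ord i) (leq_pred n). Qed.

Fact upper_subproof (n : nat) (i : 'I_n.-1) : (i.+1 < n)%N.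
Proof. by rewrite -ltn_predRL ltn_ord. Qed.

Definition lower (n : nat) (i : 'I_n.-1) : 'I_n := Ordinal (lower_subproof i).
Definition upper (n : nat) (i : 'I_n.-1) : 'I_n := Ordinal (upper_subproof i).

Definition letter (n : nat) (b : braid_word n) (k : 'I_(size b)) : 'I_n.-1 :=
  tnth (in_tuple b) k.

Definition braid_matrix_gen (K : fieldType) (n : nat) (i : 'I_n.-1) (z : K) :
    'M[K]_n :=
  \matrix_(r, c)
    if (r == lower i) && (c == lower i) then z
    else if (r == lower i) && (c == upper i) then -1
    else if (r == upper i) && (c == lower i) then 1
    else if (r == upper i) && (c == upper i) then 0
    else (r == c)%:R.

Definition braid_matrix (K : fieldType) (n : nat) (b : braid_word n)
    (z : 'rV[K]_(size b)) : 'M[K]_n :=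
  \big[mulmx/1%:M]_(k < size b) braid_matrix_gen (letter k) (z 0 k).

Definition leading_minor (K : fieldType) (n : nat) (A : 'M[K]_n) (i : 'I_n) : K :=
  let w := widen_ord (ltnW (ltn_ord i)) in
  \det (\matrix_(r < i, c < i) A (w r) (w c)).

Definition BS (K : fieldType) (n : nat) (b : braid_word n)
    (z : 'rV[K]_(size b)) : Prop :=
  forall i : 'I_n, (0 < i)%N -> leading_minor (braid_matrix z) i != 0.

(* Permutations compose from left to right in MathComp, so braid_perm b maps  *)
(* the level of a strand at the left end to its level at the right end; it is *)
(* the inverse of the product taken with the other convention, and has the    *)
(* same orbits.                                                               *)
Definition braid_perm (n : nat) (b : braid_word n) : 'S_n :=
  (\prod_(i <- b) tperm (lower i) (upper i))%g.

Definition strand_at (n : nat) (b : braid_word n) (k : nat) (l : 'I_n) : 'I_n :=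
  ((braid_perm (take k b))^-1)%g l.

Definition lower_strand (n : nat) (b : braid_word n) (k : 'I_(size b)) : 'I_n :=
  strand_at b k (lower (letter k)).
Definition upper_strand (n : nat) (b : braid_word n) (k : 'I_(size b)) : 'I_n :=
  strand_at b k (upper (letter k)).

Definition components (n : nat) (b : braid_word n) : {set {set 'I_n}} :=
  porbits (braid_perm b).

Definition strands_of (n : nat) (b : braid_word n) (C : {set {set 'I_n}}) :
    {set 'I_n} :=
  [set k | porbit (braid_perm b) k \in C].

Definition crossing_in (n : nat) (b : braid_word n) (I : {set 'I_n})
    (k : 'I_(size b)) : bool :=
  (lower_strand k \in I) && (upper_strand k \in I).

(* Once the strands outside I are deleted, the new level of the lower strand  *)
(* of a crossing is the number of strands of I below it.                      *)
Definition sub_level (n : nat) (b : braid_word n) (I : {set 'I_n})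
    (k : 'I_(size b)) : nat :=
  #|[set l : 'I_n | (l < letter k)%N && (strand_at b k l \in I)]|.

Definition sub_levels (n : nat) (b : braid_word n) (I : {set 'I_n}) : seq nat :=
  [seq sub_level I k | k <- enum 'I_(size b) & crossing_in I k].

Definition sub_braid (n : nat) (b : braid_word n) (I : {set 'I_n}) :
    braid_word #|I| :=
  pmap insub (sub_levels b I).

Lemma sub_level_bound (n : nat) (b : braid_word n) (I : {set 'I_n})
    (k : 'I_(size b)) : crossing_in I k -> (sub_level I k < #|I|.-1)%N.
Proof.
move=> /andP[hl hu]; rewrite ltn_predRL.
pose st := (braid_perm (take k b))^-1%g.
have -> : #|I| = #|[set l : 'I_n | strand_at b k l \in I]|.
  rewrite -(card_imset _ (@perm_inj _ (st^-1)%g)); apply: eq_card => l.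
  rewrite inE; apply/imsetP/idP => [[x xI ->]|h].
    by rewrite /strand_at -/st -permM mulVg perm1.
  by exists (st l) => //; rewrite -permM mulgV perm1.
pose A := [set l : 'I_n | (l < letter k)%N && (strand_at b k l \in I)].
have -> : (sub_level I k).+2 =
    #|lower (letter k) |: (upper (letter k) |: A)|.
  rewrite !cardsU1 !inE /= ltnn (ltnNge (letter k).+1) leqnSn -val_eqE /=.
  by rewrite ltn_eqF.
apply: subset_leq_card; apply/subsetP => l; rewrite !inE.
by case/or3P => [/eqP->|/eqP->|/andP[]].
Qed.

(* The partial map insub in sub_braid discards no letter. *)
Lemma val_sub_braid (n : nat) (b : braid_word n) (I : {set 'I_n}) :
  map val (sub_braid b I) = sub_levels b I.
Proof.
rewrite /sub_braid; have : all (fun m => m < #|I|.-1)%N (sub_levels b I).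
  apply/allP => m /mapP[k]; rewrite mem_filter => /andP[hk _] ->.
  exact: sub_level_bound.
elim: (sub_levels b I) => //= m s IHs /andP[hm hs].
by rewrite insubT /= IHs.
Qed.

Definition sub_torus (K : fieldType) (n : nat) (I1 I2 : {set 'I_n})
    (t : 'rV[K]_n) : Prop :=
  (forall i, t 0 i != 0) /\
  (forall i j, (i \in I1) && (j \in I1) || (i \in I2) && (j \in I2) ->
     t 0 i = t 0 j).

Definition torus_act (K : fieldType) (n : nat) (b : braid_word n)
    (t : 'rV[K]_n) (z : 'rV[K]_(size b)) : 'rV[K]_(size b) :=
  \row_k (t 0 (lower_strand k) / t 0 (upper_strand k) * z 0 k).

Definition BS_fixed (K : fieldType) (n : nat) (b : braid_word n)
    (I1 I2 : {set 'I_n}) (z : 'rV[K]_(size b)) : Prop :=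
  BS z /\ forall t : 'rV[K]_n, sub_torus I1 I2 t -> torus_act t z = z.

Definition peval (K : fieldType) (a : nat) (p : {mpoly K[a]}) (x : 'rV[K]_a) : K :=
  p.@[fun k => x 0 k].

(* Regular functions on a locally closed subset X of affine space: near every *)
(* point x of X, on some basic Zariski neighbourhood h != 0 of x, the         *)
(* function is a quotient of polynomials whose denominator has no zero there. *)
Definition regular_on (K : fieldType) (a : nat) (X : 'rV[K]_a -> Prop)
    (f : 'rV[K]_a -> K) : Prop :=
  forall x, X x -> exists p q h : {mpoly K[a]},
    peval h x != 0 /\
    forall y, X y -> peval h y != 0 ->
      peval q y != 0 /\ f y = peval p y / peval q y.

Definition is_morphism (K : fieldType) (a c : nat) (X : 'rV[K]_a -> Prop)
    (Y : 'rV[K]_c -> Prop) (f : 'rV[K]_a -> 'rV[K]_c) : Prop :=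
  (forall x, X x -> Y (f x)) /\
  (forall j, regular_on X (fun x => f x 0 j)).

Definition isomorphic (K : fieldType) (a c : nat) (X : 'rV[K]_a -> Prop)
    (Y : 'rV[K]_c -> Prop) : Prop :=
  exists (f : 'rV[K]_a -> 'rV[K]_c) (g : 'rV[K]_c -> 'rV[K]_a),
    [/\ is_morphism X Y f, is_morphism Y X g,
        forall x, X x -> g (f x) = x & forall y, Y y -> f (g y) = y].

Definition variety_prod (K : fieldType) (a c : nat) (X : 'rV[K]_a -> Prop)
    (Y : 'rV[K]_c -> Prop) (z : 'rV[K]_(a + c)) : Prop :=
  X (lsubmx z) /\ Y (rsubmx z).

(* Main.v *)
(* Applying the torus element equal to 2 on I1 and to 1 on I2 shows that the  *)
(* fixed locus is cut out of BS(b) by z_k = 0 for all crossings k between a   *)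
(* strand of I1 and a strand of I2. At such a crossing the matrix B_i(0) is a *)
(* signed permutation matrix, so it only moves columns and changes a sign.    *)
(* Hence every partial product of the B_i(z_k), with columns indexed by       *)
(* levels, is block diagonal for the partition of the strands into I1 and I2, *)
(* and its I1-block is the corresponding partial product for the deleted      *)
(* braid b_1, up to a sign for each strand: the signs can be pushed through   *)
(* the remaining crossings at the cost of replacing z_k by +-z_k. Since I1    *)
(* and I2 are unions of orbits, the columns at the right end are indexed by   *)
(* I1 and I2 again, and each leading minor of B_b is up to sign the product   *)
(* of a leading minor of B_{b_1} and one of B_{b_2}. All leading minors of    *)
(* the two factors occur in this way, apart from full determinants, which are *)
(* equal to 1. So the isomorphism is z |-> (+-z_k), a signed projection.      *)
Require Import Defs.
From HB Require Import structures.
From mathcomp Require Import all_boot all_order all_fingroup all_algebra.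
From mathcomp Require Import mpoly reals complex ring zify.

Set Implicit Arguments.
Unset Strict Implicit.
Unset Printing Implicit Defensive.

Import GRing.Theory Num.Theory.
Local Open Scope ring_scope.
Local Open Scope complex_scope.

(** The torus fixes [z] exactly when [z] vanishes at every crossing between [I] and its complement
    ([BS_fixedE]). Such a crossing only swaps two columns up to sign, so every partial product stays
    block diagonal ([word_entry_off]), and its block on [I] is, up to column signs, the partial
    product of the deleted braid in sign-changed variables ([word_entry_diag]). As [I] is a union of
    orbits, rows and columns of the full product carry the same labels, so each leading minor is a
    sign times one leading minor from each factor ([minorn_split]). Every minor of a factor arises
    so ([rank_onto]), and minors of size zero or full size equal 1, so the open conditions agree
    ([BS_split]). The isomorphism is the signed projection [split_mx]; its inverse on the fixed
    locus is the transpose ([split_mxK], [split_mxTK]). *)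

(** * Braid matrices as column operations *)

(* The action of braid_matrix_gen on columns from the right. Entries are      *)
(* indexed by nat, so that braids on different numbers of strands compare     *)
(* without casts.                                                             *)
Definition crossing (K : fieldType) (f : nat -> nat -> K) (p : nat * K) :
    nat -> nat -> K := fun r c =>
  if c == p.1 then p.2 * f r p.1 + f r p.1.+1
  else if c == p.1.+1 then - f r p.1 else f r c.

Definition word_entry (K : fieldType) (w : seq (nat * K)) : nat -> nat -> K :=
  foldl (@crossing K) (fun r c => (r == c)%:R) w.

Definition coded (K : fieldType) (n : nat) (b : braid_word n)
    (z : 'rV[K]_(size b)) : seq (nat * K) :=
  [seq (val (letter k), z 0 k) | k <- enum 'I_(size b)].

Lemma mul_braid_matrix_gen (K : fieldType) (n : nat) (f : nat -> nat -> K)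
    (i : 'I_n.-1) (z : K) :
  (\matrix_(r < n, c < n) f r c) *m braid_matrix_gen i z =
  \matrix_(r, c) crossing f (val i, z) r c.
Proof.
have lu : (upper i == lower i) = false by rewrite -val_eqE /= gtn_eqF.
apply/matrixP => r c; rewrite !mxE /crossing /=.
have [->|cl] := eqVneq c (lower i).
  rewrite (bigD1 (lower i)) // (bigD1 (upper i)) ?lu //= big1 => [|l].
    by rewrite !mxE /= !eqxx /= lu /=; ring.
  by case/andP => ll lup; rewrite !mxE eqxx (negPf ll) (negPf lup) mulr0.
rewrite -[val c == i]/(c == lower i) (negPf cl).
have [->|cu] := eqVneq c (upper i).
  rewrite eqxx (bigD1 (lower i)) //= big1 => [|l ll].
    by rewrite !mxE !eqxx lu /= addr0 mulrN1.
  rewrite !mxE eqxx lu (negPf ll) /=; case: (l == upper i) => /=; rewrite ?mulr0 //.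
rewrite -[val c == i.+1]/(c == upper i) (negPf cu).
rewrite (bigD1 c) //= big1 => [|l ll].
  by rewrite !mxE (negPf cl) (negPf cu) !andbF eqxx addr0 mulr1.
by rewrite !mxE (negPf cl) (negPf cu) !andbF (negPf ll) mulr0.
Qed.

Lemma braid_matrixE (K : fieldType) (n : nat) (b : braid_word n)
    (z : 'rV[K]_(size b)) :
  braid_matrix z = \matrix_(r, c) word_entry (coded z) r c.
Proof.
have main (s : seq ('I_n.-1 * K)) (f : nat -> nat -> K) :
    (\matrix_(r < n, c < n) f r c) *m \big[mulmx/1%:M]_(p <- s) braid_matrix_gen p.1 p.2 =
    \matrix_(r, c) foldl (@crossing K) f [seq (val p.1, p.2) | p <- s] r c.
  elim: s f => [|p s IHs] f; first by rewrite big_nil mulmx1.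
  by rewrite big_cons mulmxA mul_braid_matrix_gen IHs.
pose F (k : 'I_(size b)) := (letter k, z 0 k).
rewrite (_ : coded z = [seq (val p.1, p.2) | p <- map F (enum 'I_(size b))]).
  rewrite -[LHS]mul1mx /braid_matrix [index_enum _]unlock -enumT.
  rewrite -[X in _ *m X](big_map F xpredT (fun p => braid_matrix_gen p.1 p.2)).
  rewrite [X in X *m _](_ : _ =
    \matrix_(r < n, c < n) (fun r c : nat => (r == c)%:R) r c).
    exact: main.
  by apply/matrixP => r c; rewrite !mxE.
by rewrite -map_comp.
Qed.

(** Linearity in the row [lower i]: the part with coefficient [z] has two equal rows, and the part
    with coefficient -1 is a transposition matrix, of determinant -1. *)
Lemma det_braid_matrix_gen (K : fieldType) (n : nat) (i : 'I_n.-1) (z : K) :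
  \det (braid_matrix_gen i z) = 1.
Proof.
have lu : (upper i == lower i) = false by rewrite -val_eqE /= gtn_eqF.
pose Q := \matrix_(r, c) (if r == lower i then (c == lower i)%:R
   else braid_matrix_gen i z r c).
rewrite (@determinant_multilinear _ _ _
  (perm_mx (tperm (lower i) (upper i))) Q (lower i) (-1) z).
- have -> : \det Q = 0.
    apply: (@determinant_alternate _ _ _ (lower i) (upper i)).
      by rewrite eq_sym lu.
    move=> c; rewrite !mxE eqxx lu /=.
    by rewrite eqxx [upper i == c]eq_sym /=; case: (c == _) => //=; case: eqP.
  rewrite det_perm odd_tperm eq_sym lu /= expr1; ring.
- apply/rowP => c; rewrite !mxE eqxx /= tpermL.
  have [->|cl] := eqVneq c (lower i); first by rewrite lu /=; ring.
  rewrite andbF [lower i == _]eq_sym lu [upper i == c]eq_sym /=.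
  by case: (c == upper i); rewrite /=; ring.
- apply/matrixP => r c; rewrite !mxE /=.
  have ne : lift (lower i) r != lower i by rewrite eq_sym neq_lift.
  rewrite (negPf ne) /=; case: tpermP => [e|->|_ /eqP nu].
  + by rewrite e eqxx in ne.
  + rewrite eqxx /= [lower i == c]eq_sym.
    by case: (c == lower i) => //=; rewrite eq_sym; case: eqP.
  + by rewrite (negPf nu).
- by apply/matrixP => r c; rewrite !mxE eq_sym (negPf (neq_lift _ _)).
Qed.

Lemma det_braid_matrix (K : fieldType) (n : nat) (b : braid_word n)
    (z : 'rV[K]_(size b)) : \det (braid_matrix z) = 1.
Proof.
apply: (big_ind (fun A => \det A = 1)) => [|A B dA dB|k _].
- exact: det1.
- by rewrite det_mulmx dA dB mulr1.
- exact: det_braid_matrix_gen.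
Qed.

(** * Levels, ranks and signs of a set of strands *)

Definition swapn (j l : nat) : nat :=
  if l == j then j.+1 else if l == j.+1 then j else l.

(** The level that a strand of [P] at level [l] gets once the strands outside [P] are deleted. *)
Definition rank (P : pred nat) (l : nat) : nat := \sum_(0 <= i < l) P i.

Lemma rankS (P : pred nat) (l : nat) : rank P l.+1 = (rank P l + P l)%N.
Proof. by rewrite /rank big_nat_recr. Qed.

Lemma eq_rank (P Q : pred nat) (l : nat) :
  (forall i, (i < l)%N -> P i = Q i) -> rank P l = rank Q l.
Proof. by move=> e; apply: eq_big_nat => i /andP[_ /e->]. Qed.

Lemma leq_rank (P : pred nat) (l m : nat) : (l <= m)%N -> (rank P l <= rank P m)%N.
Proof. by move/subnK<-; elim: (m - l)%N => // d; rewrite addSn rankS; lia. Qed.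

Lemma ltn_rank (P : pred nat) (l m : nat) :
  P l -> (l < m)%N -> (rank P l < rank P m)%N.
Proof. by move=> Pl /(leq_rank P); rewrite rankS Pl addn1. Qed.

Lemma rank_inj (P : pred nat) : {in P &, injective (rank P)}.
Proof.
move=> l m Pl Pm e; case: (ltngtP l m) => // [lm|ml].
  by have := ltn_rank Pl lm; rewrite e ltnn.
by have := ltn_rank Pm ml; rewrite e ltnn.
Qed.

Lemma rankC (P : pred nat) (l : nat) : (rank P l + rank (predC P) l = l)%N.
Proof.
elim: l => [|l IHl]; first by rewrite /rank !big_geq.
by rewrite !rankS addnACA IHl /=; case: (P l); rewrite addn1.
Qed.

(** Exchanging two neighbours changes the count below [l] only if [l] separates them. *)
Lemma rank_swap (P : pred nat) (j l : nat) :
  l != j.+1 -> rank (fun i => P (swapn j i)) l = rank P l.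
Proof.
have lo m : (m <= j)%N -> rank (fun i => P (swapn j i)) m = rank P m.
  move=> mj; apply: eq_rank => i im.
  by rewrite /swapn !ltn_eqF //; lia.
case: (leqP l j) => [/lo //|jl] ne.
have /subnK <- : (j.+2 <= l)%N by lia.
elim: (l - _)%N => [|d IHd]; last first.
  rewrite addSn !rankS IHd /swapn !gtn_eqF //; lia.
rewrite add0n !rankS lo // /swapn eqxx eqn_leq ltnn /= eqxx.
by rewrite -addnA [(P j.+1 + _)%N]addnC addnA.
Qed.

(* P0 is a set of strands, given by their levels at the left end, and j k is  *)
(* the letter at position k; level_in j P0 k is the set of the levels of      *)
(* these strands just before the crossing k.                                  *)
Fixpoint level_in (j : nat -> nat) (P0 : pred nat) (k : nat) : pred nat :=
  if k is k'.+1 then fun l => level_in j P0 k' (swapn (j k') l) else P0.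

Definition mixed (j : nat -> nat) (P0 : pred nat) (k : nat) : bool :=
  level_in j P0 k (j k) != level_in j P0 k (j k).+1.

Definition pure (j : nat -> nat) (P0 : pred nat) (k : nat) : bool :=
  level_in j P0 k (j k) && level_in j P0 k (j k).+1.

(* The sign of the strand at level l before the crossing k: it changes when   *)
(* the strand is the lower one at a mixed crossing, because of the entry -1   *)
(* of B_i(0).                                                                 *)
Fixpoint strand_sign (K : fieldType) (j : nat -> nat) (P0 : pred nat) (k l : nat) : K :=
  if k is k'.+1 then
    (if mixed j P0 k' && (l == (j k').+1) then -1 else 1)
    * strand_sign K j P0 k' (swapn (j k') l)
  else 1.

(** If the columns at the two levels are [s * g] and [s' * g'] with signs [s], [s'], then
    [z * (s * g) + s' * g'] equals [s' * ((s * s' * z) * g + g')]: the variable absorbs [s * s'],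
    and the upper strand keeps its sign [s']. *)
Definition crossing_sign (K : fieldType) (j : nat -> nat) (P0 : pred nat) (k : nat) : K :=
  strand_sign K j P0 k (j k) * strand_sign K j P0 k (j k).+1.

Definition subword (K : fieldType) (j : nat -> nat) (P0 : pred nat) (z : nat -> K)
    (k : nat) : seq (nat * K) :=
  [seq (rank (level_in j P0 i) (j i), crossing_sign K j P0 i * z i)
     | i <- iota 0 k & pure j P0 i].

Lemma level_inC j P0 k l : level_in j (predC P0) k l = ~~ level_in j P0 k l.
Proof. by elim: k l => //= k IHk l; rewrite IHk. Qed.

Lemma mixedC j P0 k : mixed j (predC P0) k = mixed j P0 k.
Proof. by rewrite /mixed !level_inC; do 2!case: (level_in _ _ _ _). Qed.

(** Mixed crossings are the same for a set and its complement, so one family of signs serves both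
    blocks. *)
Lemma strand_signC (K : fieldType) j P0 k l :
  strand_sign K j (predC P0) k l = strand_sign K j P0 k l.
Proof. by elim: k l => //= k IHk l; rewrite IHk mixedC. Qed.

Lemma strand_sign_sqr (K : fieldType) j P0 k l :
  strand_sign K j P0 k l * strand_sign K j P0 k l = 1.
Proof.
elim: k l => [|k IHk] l /=; first by rewrite mulr1.
by rewrite mulrACA IHk mulr1; case: ifP; rewrite ?mulrNN mulr1.
Qed.

(** * Block structure of the partial products *)

Lemma iota_rcons k : iota 0 k.+1 = rcons (iota 0 k) k.
Proof. by rewrite -addn1 iotaD cats1. Qed.

(** A crossing within one class combines columns that vanish on the same rows; a mixed one has
    [z = 0] and moves columns together with their labels. *)
Lemma word_entry_off (K : fieldType) j P0 (z : nat -> K) k :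
  (forall i, (i < k)%N -> mixed j P0 i -> z i = 0) ->
  forall r l, P0 r != level_in j P0 k l ->
  word_entry [seq (j i, z i) | i <- iota 0 k] r l = 0.
Proof.
elim: k => [|k IHk] z0 r l.
  by rewrite /word_entry /=; case: (r =P l) => [->|//]; rewrite eqxx.
have {}IHk := IHk (fun i ik => z0 i (ltnW ik)).
have := z0 k (ltnSn k); rewrite /mixed.
rewrite iota_rcons map_rcons /word_entry foldl_rcons -/(word_entry _).
rewrite /crossing /= /swapn; have [_|lj] := eqVneq l (j k).
  move=> zk ne; rewrite (IHk r (j k).+1 ne) addr0.
  have [e|/zk->] := eqVneq (level_in j P0 k (j k)) (level_in j P0 k (j k).+1).
    by rewrite IHk ?mulr0 // e.
  by rewrite mul0r.
by case: (eqVneq l (j k).+1) => [_|_] _ ne; rewrite IHk ?oppr0.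
Qed.

Lemma word_entry_diag (K : fieldType) j P0 (z : nat -> K) k :
  (forall i, (i < k)%N -> mixed j P0 i -> z i = 0) ->
  forall r l, P0 r -> level_in j P0 k l ->
  word_entry [seq (j i, z i) | i <- iota 0 k] r l =
  strand_sign K j P0 k l *
    word_entry (subword j P0 z k) (rank P0 r) (rank (level_in j P0 k) l).
Proof.
elim: k => [|k IHk] z0 r l Pr.
  rewrite /= => Pl; rewrite /word_entry /= mul1r.
  by congr (nat_of_bool _)%:R; apply/eqP/eqP => [->//|]; apply: rank_inj.
have {}IHk := IHk (fun i ik => z0 i (ltnW ik)) r.
have zk := z0 k (ltnSn k).
rewrite /subword iota_rcons filter_rcons map_rcons {1}/word_entry foldl_rcons.
rewrite -/(word_entry _) /crossing /=.
set f := word_entry _ in IHk *; set s := strand_sign K j P0 k in IHk *.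
have s2 i : s i * s i = 1 by apply: strand_sign_sqr.
pose P := level_in j P0 k; rewrite -/P in IHk *.
pose g := word_entry (subword j P0 z k) (rank P0 r).
rewrite -/(subword j P0 z k) in IHk *.
have {}IHk i : P i -> f r i = s i * g (rank P i) by apply: IHk.
set i := j k.
have rkS := rankS P i.
rewrite /mixed -/P -/i in zk *; rewrite /pure -/P -/i.
have rkj : rank (fun l => P (swapn i l)) i = rank P i.
  by rewrite rank_swap // ltn_eqF.
have rkj1 : rank (fun l => P (swapn i l)) i.+1 = (rank P i + P i.+1)%N.
  by rewrite rankS rkj /swapn eqxx.
case Pi: (P i) zk rkS => zk rkS; case Pi1: (P i.+1) zk rkj1 => zk rkj1;
  rewrite ?Pi ?Pi1 /= in zk rkS rkj1 *.
(* Both strands are kept: their ranks are consecutive, and the deleted word performs the same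
   crossing. The sign of the upper strand is factored out by [s2]. *)
- rewrite addn1 in rkS rkj1.
  rewrite map_rcons /word_entry foldl_rcons -/(word_entry _) /crossing /= -/g.
  rewrite [swapn i l]/swapn; have [->|li] := eqVneq l i.
    move=> _; rewrite rkj eqxx -rkS !IHk // /crossing_sign -/i -/s mul1r.
    rewrite mulrDr -!mulrA !(mulrCA _ (s i.+1)) (mulrA (s i.+1) (s i.+1)) s2 mul1r.
    by rewrite (mulrCA (z k)).
  have [->|li1] := eqVneq l i.+1.
    by move=> _; rewrite rkj1 eqxx gtn_eqF // IHk // mul1r mulrN.
  move=> Pl; rewrite rank_swap // -rkS IHk // mul1r.
  have -> : (rank P l == rank P i) = false.
    by apply/negP => /eqP /(rank_inj Pl Pi)/eqP; apply/negP.
  have -> : (rank P l == rank P i.+1) = false.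
    by apply/negP => /eqP /(rank_inj Pl Pi1)/eqP; apply/negP.
  by [].
(* Only the lower strand is kept: it moves up one level at unchanged rank, and the entry -1 flips
   its sign. *)
- rewrite -/(subword j P0 z k) -/g zk // [swapn i l]/swapn.
  have [->|li] := eqVneq l i; first by rewrite Pi1.
  have [->|li1] := eqVneq l i.+1.
    by move=> _; rewrite rkj1 addn0 IHk // mulN1r mulNr.
  by move=> Pl; rewrite rank_swap // IHk // mul1r.
(* Only the upper strand is kept: it moves down with rank and sign unchanged. *)
- rewrite -/(subword j P0 z k) -/g zk // [swapn i l]/swapn.
  have [->|li] := eqVneq l i.
    by move=> _; rewrite rkj mul0r add0r IHk // rkS addn0 ltn_eqF // mul1r.
  have [->|li1] := eqVneq l i.+1; first by rewrite Pi.
  by move=> Pl; rewrite rank_swap // IHk // mul1r.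
- rewrite -/(subword j P0 z k) -/g [swapn i l]/swapn.
  have [->|li] := eqVneq l i; first by rewrite Pi1.
  have [->|li1] := eqVneq l i.+1; first by rewrite Pi.
  by move=> Pl; rewrite rank_swap // IHk // mul1r.
Qed.

(** * Leading minors and their factorization *)

Definition minorn (K : fieldType) (f : nat -> nat -> K) (m : nat) : K :=
  \det (\matrix_(r < m, c < m) f r c).

Lemma leading_minorE (K : fieldType) (n : nat) (b : braid_word n)
    (z : 'rV[K]_(size b)) (i : 'I_n) :
  leading_minor (braid_matrix z) i = minorn (word_entry (coded z)) i.
Proof.
rewrite /leading_minor /minorn braid_matrixE; congr (\det _).
by apply/matrixP => r c; rewrite !mxE.
Qed.

Lemma minorn_full (K : fieldType) (n : nat) (b : braid_word n)
    (z : 'rV[K]_(size b)) : minorn (word_entry (coded z)) n = 1.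
Proof. by rewrite /minorn -braid_matrixE det_braid_matrix. Qed.

Lemma det_reindex (K : fieldType) (m : nat) (A : 'M[K]_m) (h : 'I_m -> 'I_m) :
  injective h -> \det (\matrix_(r, c) A (h r) (h c)) = \det A.
Proof.
move=> h_inj; pose s := perm h_inj.
rewrite (_ : \matrix_(r, c) _ = row_perm s (col_perm s A)); last first.
  by apply/matrixP => r c; rewrite !mxE !permE.
rewrite row_permE col_permE !det_mulmx !det_perm odd_permV.
by rewrite mulrCA -signr_addb addbb mulr1.
Qed.

(** The same reordering of rows and columns, which leaves the determinant unchanged, makes the
    matrix block diagonal up to scaling the columns by [s]. *)
Lemma minorn_split (K : fieldType) (P : pred nat) (f g1 g2 : nat -> nat -> K)
    (s : nat -> K) (m : nat) :
  (forall r c, (r < m)%N -> (c < m)%N -> P r != P c -> f r c = 0) ->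
  (forall r c, (r < m)%N -> (c < m)%N -> P r -> P c ->
     f r c = s c * g1 (rank P r) (rank P c)) ->
  (forall r c, (r < m)%N -> (c < m)%N -> ~~ P r -> ~~ P c ->
     f r c = s c * g2 (rank (predC P) r) (rank (predC P) c)) ->
  minorn f m = (\prod_(c < m) s c) *
    (minorn g1 (rank P m) * minorn g2 (rank (predC P) m)).
Proof.
set a := rank P m; set d := rank (predC P) m => f0 f1 f2.
have em : (a + d = m)%N := rankC P m.
(* Lists the indices in [P] first and the others after them, each group in increasing order. *)
pose h0 r := if P r then rank P r else (a + rank (predC P) r)%N.
have h0lt r : (r < m)%N -> (h0 r < a + d)%N.
  rewrite /h0; case: ifPn => Pr rm.
    by apply: leq_trans (ltn_rank Pr rm) (leq_addr _ _).
  by rewrite ltn_add2l (@ltn_rank (predC P)).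
have h0lta r : (r < m)%N -> P r -> (rank P r < a)%N by move=> *; apply: ltn_rank.
have h0_inj r c : (r < m)%N -> (c < m)%N -> h0 r = h0 c -> r = c.
  move=> rm cm; rewrite /h0; case: ifPn => Pr; case: ifPn => Pc.
  - exact: rank_inj.
  - by have := h0lta r rm Pr; lia.
  - by have := h0lta c cm Pc; lia.
  - by move/addnI; apply: (@rank_inj (predC P)).
pose G r c := if (r < a)%N then (if (c < a)%N then g1 r c else 0)
   else if (c < a)%N then 0 else g2 (r - a)%N (c - a)%N.
have -> : minorn g1 a * minorn g2 d = minorn G (a + d).
  rewrite /minorn -(det_ublock _ 0); congr (\det _); apply/matrixP => r c.
  rewrite !mxE; case: splitP => r' er; rewrite !mxE; case: splitP => c' ec;
    rewrite !mxE /G ?er ?ec ?ltn_ord ?ltnNge ?leq_addr //=.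
  by rewrite !addKn.
rewrite em in h0lt *.
pose h (r : 'I_m) := Ordinal (h0lt r (ltn_ord r)).
have h_inj : injective h.
  by move=> r c [] /(h0_inj _ _ (ltn_ord r) (ltn_ord c)) /val_inj.
rewrite /minorn -[X in _ * X](det_reindex _ h_inj) mulrC.
have -> : \prod_(c < m) s c = \det (diag_mx (\row_(c < m) s c)).
  by rewrite det_diag; apply: eq_bigr => c _; rewrite mxE.
rewrite -det_mulmx; congr (\det _); apply/matrixP => r c.
rewrite mul_mx_diag !mxE /= /G /h0.
have [rm cm] := (ltn_ord r, ltn_ord c).
case: (boolP (P r)) (boolP (P c)) => Pr [] Pc /=.
- by rewrite !h0lta // f1 // mulrC.
- by rewrite h0lta // ltnNge leq_addr /= mul0r f0 // Pr (negPf Pc).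
- by rewrite h0lta // ltnNge leq_addr /= mul0r f0 // Pc (negPf Pr).
- by rewrite !ltnNge !leq_addr /= !addKn f2 // mulrC.
Qed.

Lemma minorn0 (K : fieldType) (f : nat -> nat -> K) : minorn f 0 = 1.
Proof. exact: det_mx00. Qed.

(** The added sizes 0 and [n] cost nothing, both minors being 1. They are included because a proper
    minor of the braid may restrict to an empty or full minor of a factor. *)
Lemma BS_minorn (K : fieldType) (n : nat) (b : braid_word n) (z : 'rV[K]_(size b)) :
  BS z <-> forall m, (m <= n)%N -> minorn (word_entry (coded z)) m != 0.
Proof.
split=> [zBS [|m] mn | nz i _]; last by rewrite leading_minorE nz // ltnW.
  by rewrite minorn0 oner_eq0.
move: mn; rewrite leq_eqVlt => /predU1P[->|mn].
  by rewrite minorn_full oner_eq0.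
by have := zBS (Ordinal mn) isT; rewrite leading_minorE.
Qed.

(** The rank starts at 0 and grows by at most one per step, so it skips no value. *)
Lemma rank_onto (P : pred nat) (m d : nat) :
  (d <= rank P m)%N -> exists2 i, (i <= m)%N & rank P i = d.
Proof.
elim: m => [|m IHm].
  by rewrite {1}/rank big_geq // leqn0 => /eqP->; exists 0%N => //; rewrite /rank big_geq.
have [/IHm[i im <-] _|dm] := leqP d (rank P m).
  by exists i => //; apply: leqW.
by move=> dm'; exists m.+1 => //; move: dm'; rewrite rankS; case: (P m); lia.
Qed.

Lemma card_rank (n : nat) (P : pred nat) (j : nat) :
  (j <= n)%N -> #|[set l : 'I_n | (l < j)%N && P l]| = rank P j.
Proof.
move=> jn; rewrite /rank big_mkord (big_ord_widen n (fun i => P i : nat)) //.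
rewrite -sum1_card big_mkcond [RHS]big_mkcond; apply: eq_bigr => i _.
by rewrite inE; case: (i < j)%N; case: (P i).
Qed.

(** * From the typed braid words to words indexed by natural numbers *)

Definition letter_at (n : nat) (b : braid_word n) (k : nat) : nat :=
  nth 0%N (map val b) k.

Definition entry_at (K : fieldType) (m : nat) (z : 'rV[K]_m) (i : nat) : K :=
  if insub i is Some k then z 0 k else 0.

Lemma entry_atE (K : fieldType) (m : nat) (z : 'rV[K]_m) (k : 'I_m) : entry_at z k = z 0 k.
Proof. by rewrite /entry_at valK. Qed.

Lemma letter_atE (n : nat) (b : braid_word n) (k : 'I_(size b)) :
  letter_at b k = letter k.
Proof.
by rewrite /letter_at (nth_map (letter k)) // [letter k in RHS](tnth_nth (letter k)).
Qed.

Lemma map_enum_ord (T : Type) (m : nat) (F : nat -> T) :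
  [seq F (val k) | k <- enum 'I_m] = [seq F i | i <- iota 0 m].
Proof. by rewrite -val_enum_ord -map_comp. Qed.

Lemma codedE (K : fieldType) (n : nat) (b : braid_word n) (z : 'rV[K]_(size b)) :
  coded z = [seq (letter_at b i, entry_at z i) | i <- iota 0 (size b)].
Proof.
rewrite -(map_enum_ord _ (fun i => (letter_at b i, entry_at z i))).
by apply: eq_map => k; rewrite letter_atE entry_atE.
Qed.

Lemma strand_atS (n : nat) (b : braid_word n) (k : 'I_(size b)) (l : 'I_n) :
  strand_at b k.+1 l = strand_at b k (tperm (lower (letter k)) (upper (letter k)) l).
Proof.
rewrite /strand_at (take_nth (letter k)) // /braid_perm -cats1 big_cat big_seq1 /=.
by rewrite invMg permM tpermV [letter k in RHS](tnth_nth (letter k)).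
Qed.

Section Strands.
Variables (n : nat) (b : braid_word n) (I : {set 'I_n}) (P0 : pred nat).
Hypothesis P0I : forall l : 'I_n, P0 l = (l \in I).

Lemma level_inE (k : nat) (l : 'I_n) :
  (k <= size b)%N -> level_in (letter_at b) P0 k l = (strand_at b k l \in I).
Proof.
elim: k l => [|k IHk] l kb.
  by rewrite /= P0I /strand_at take0 /braid_perm big_nil invg1 perm1.
have := strand_atS (Ordinal kb) l; have := letter_atE (Ordinal kb).
move: (letter (Ordinal kb)) => i /= ki ->; rewrite -IHk ?(ltnW kb) // ki.
congr (level_in _ _ _ _).
rewrite /swapn; case: tpermP => [->|->|/eqP nl /eqP nu] /=; rewrite ?eqxx //.
  by rewrite gtn_eqF.
by move: nl nu; rewrite -!val_eqE /= => /negPf-> /negPf->.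
Qed.

Lemma level_in_lower (k : 'I_(size b)) :
  level_in (letter_at b) P0 k (letter_at b k) = (lower_strand k \in I).
Proof. by rewrite letter_atE -level_inE // ltnW. Qed.

Lemma level_in_upper (k : 'I_(size b)) :
  level_in (letter_at b) P0 k (letter_at b k).+1 = (upper_strand k \in I).
Proof. by rewrite letter_atE -level_inE // ltnW. Qed.

Lemma pureE (k : 'I_(size b)) : pure (letter_at b) P0 k = crossing_in I k.
Proof. by rewrite /pure level_in_lower level_in_upper. Qed.

Lemma mixedE (k : 'I_(size b)) :
  mixed (letter_at b) P0 k = ((lower_strand k \in I) != (upper_strand k \in I)).
Proof. by rewrite /mixed level_in_lower level_in_upper. Qed.

Lemma sub_levelE (k : 'I_(size b)) :
  sub_level I k = rank (level_in (letter_at b) P0 k) (letter_at b k).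
Proof.
rewrite letter_atE -(card_rank _ (ltnW (lower_subproof (letter k)))).
by apply: eq_card => l; rewrite !inE level_inE // ltnW.
Qed.

Lemma rank_card : rank P0 n = #|I|.
Proof.
by rewrite -(@card_rank n) //; apply: eq_card => l; rewrite inE ltn_ord P0I.
Qed.

Lemma size_sub_braid : size (sub_braid b I) = #|@crossing_in n b I|.
Proof.
rewrite -(size_map val) val_sub_braid size_map cardE [in RHS]/enum_mem -enumT.
by congr size; apply: eq_filter.
Qed.

Definition sub_crossing (m : 'I_(size (sub_braid b I))) : 'I_(size b) :=
  enum_val (cast_ord size_sub_braid m).

Lemma sub_crossing_inj : injective sub_crossing.
Proof. by move=> m1 m2 /enum_val_inj/cast_ord_inj. Qed.

Lemma sub_crossingP (k : 'I_(size b)) :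
  reflect (exists m, k = sub_crossing m) (crossing_in I k).
Proof.
apply: (iffP idP) => [kI|[m ->]]; last exact: (enum_valP (cast_ord size_sub_braid m)).
exists (cast_ord (esym size_sub_braid) (enum_rank_in kI k)).
by rewrite /sub_crossing cast_ordKV enum_rankK_in.
Qed.

(** The order matters: [enum_val] lists the kept crossings from left to right, as [sub_levels] does,
    so letters and variables stay matched. *)
Lemma map_sub_crossing :
  map sub_crossing (enum 'I_(size (sub_braid b I))) =
  [seq k <- enum 'I_(size b) | crossing_in I k].
Proof.
have -> : [seq k <- enum 'I_(size b) | crossing_in I k] = enum (@crossing_in n b I).
  by rewrite [RHS]/enum_mem -enumT; apply: eq_filter.
have es : size (map sub_crossing (enum 'I_(size (sub_braid b I)))) =
    size (enum (@crossing_in n b I)).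
  by rewrite size_map size_enum_ord size_sub_braid cardE.
(* Comparison by [nth] needs a default crossing, which exists only if some crossing is kept. *)
case: (posnP (size (sub_braid b I))) => [s0|s_gt0].
  apply: etrans (esym (size0nil _)); last by rewrite -es size_map size_enum_ord.
  by apply: size0nil; rewrite size_map size_enum_ord.
pose m0 := Ordinal s_gt0.
apply: (@eq_from_nth _ (sub_crossing m0)) => // i.
rewrite size_map size_enum_ord => im.
rewrite (nth_map m0) ?size_enum_ord // /sub_crossing (enum_val_nth (sub_crossing m0)).
by rewrite /= nth_enum_ord.
Qed.

Lemma letter_sub_braid (m : 'I_(size (sub_braid b I))) :
  letter m = sub_level I (sub_crossing m) :> nat.
Proof.
rewrite -letter_atE /letter_at val_sub_braid /sub_levels -map_sub_crossing.
by rewrite -map_comp (nth_map m) ?size_enum_ord //= nth_ord_enum.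
Qed.

Variables (K : fieldType) (s : nat -> K).

(** A signed coordinate projection, encoded as a matrix so that it is visibly polynomial and its
    transpose is the extension by zero. *)
Definition restriction_mx : 'M[K]_(size b, size (sub_braid b I)) :=
  \matrix_(k, m) (s k *+ (k == sub_crossing m)).

Lemma mul_restriction_mx (z : 'rV[K]_(size b)) m :
  (z *m restriction_mx) 0 m = s (sub_crossing m) * z 0 (sub_crossing m).
Proof.
rewrite mxE (bigD1 (sub_crossing m)) //= big1 => [|k ne].
  by rewrite mxE eqxx addr0 mulrC.
by rewrite mxE (negPf ne) mulr0.
Qed.

Lemma mul_restriction_mxT (z : 'rV[K]_(size (sub_braid b I))) m :
  (z *m restriction_mx^T) 0 (sub_crossing m) = s (sub_crossing m) * z 0 m.
Proof.
rewrite mxE (bigD1 m) //= big1 => [|k ne].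
  by rewrite !mxE eqxx addr0 mulrC.
by rewrite !mxE (inj_eq sub_crossing_inj) eq_sym (negPf ne) mulr0.
Qed.

Lemma mul_restriction_mxT0 (z : 'rV[K]_(size (sub_braid b I))) k :
  ~~ crossing_in I k -> (z *m restriction_mx^T) 0 k = 0.
Proof.
move=> kI; rewrite mxE big1 // => m _; rewrite !mxE; case: eqP => [e|_].
  by case/sub_crossingP: kI; exists m.
by rewrite mulr0.
Qed.

Lemma coded_restriction_mx (z : 'rV[K]_(size b)) :
  (forall i, s i = crossing_sign K (letter_at b) P0 i) ->
  coded (z *m restriction_mx) = subword (letter_at b) P0 (entry_at z) (size b).
Proof.
move=> sE; rewrite /subword -val_enum_ord filter_map -map_comp.
rewrite (eq_filter (a2 := @crossing_in n b I)); last exact: pureE.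
rewrite -map_sub_crossing -map_comp; apply: eq_map => m /=.
by rewrite letter_sub_braid mul_restriction_mx sub_levelE sE entry_atE.
Qed.

End Strands.

(** * The signed projection onto the two factors *)

Section Splitting.
Variables (K : fieldType) (n : nat) (b : braid_word n) (I : {set 'I_n}).
Hypothesis I_stable : forall l, (strand_at b (size b) l \in I) = (l \in I).

(** Its complement also contains all numbers from [n] on; this is harmless, as ranks are only taken
    up to [n]. *)
Definition in_levels (l : nat) : bool := l \in [seq val i | i in I].

Lemma in_levelsE (l : 'I_n) : in_levels l = (l \in I).
Proof. by rewrite /in_levels (mem_map val_inj) mem_enum. Qed.

Lemma in_levelsCE (l : 'I_n) : predC in_levels l = (l \in ~: I).
Proof. by rewrite /= in_levelsE in_setC. Qed.

Definition set_sign (i : nat) : K := crossing_sign K (letter_at b) in_levels i.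

Lemma set_signC i : set_sign i = crossing_sign K (letter_at b) (predC in_levels) i.
Proof. by rewrite /crossing_sign !strand_signC. Qed.

Lemma set_sign_sqr i : set_sign i * set_sign i = 1.
Proof. by rewrite /set_sign /crossing_sign mulrACA !strand_sign_sqr mulr1. Qed.

Definition split_mx : 'M[K]_(size b, size (sub_braid b I) + size (sub_braid b (~: I))) :=
  row_mx (restriction_mx b I set_sign) (restriction_mx b (~: I) set_sign).

Definition mixed_vanish (z : 'rV[K]_(size b)) : Prop :=
  forall k, (lower_strand k \in I) != (upper_strand k \in I) -> z 0 k = 0.

(** [I_stable] makes the column labels at the right end equal to the row labels at the left end; [c]
    is the product of the strand signs. *)
Lemma minorn_coded_split z m : mixed_vanish z -> (m <= n)%N ->
  exists2 c : K, c != 0 & minorn (word_entry (coded z)) m =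
   c * (minorn (word_entry (coded (z *m restriction_mx b I set_sign)))
       (rank in_levels m) *
     minorn (word_entry (coded (z *m restriction_mx b (~: I) set_sign)))
       (rank (predC in_levels) m)).
Proof.
move=> z0 mn; set j := letter_at b.
have zmix i : (i < size b)%N -> mixed j in_levels i -> entry_at z i = 0.
  move=> ib; rewrite (mixedE in_levelsE (Ordinal ib)) (entry_atE z (Ordinal ib)).
  exact: z0.
have lev l : (l < m)%N -> level_in j in_levels (size b) l = in_levels l.
  move=> lm; have ln := leq_trans lm mn.
  by rewrite (level_inE in_levelsE (Ordinal ln)) // I_stable -in_levelsE.
have levC l : (l < m)%N -> level_in j (predC in_levels) (size b) l = predC in_levels l.
  by move=> lm; rewrite level_inC lev.
exists (\prod_(c < m) strand_sign K j in_levels (size b) c).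
  apply/prodf_neq0 => c _; apply/eqP => e.
  have := strand_sign_sqr K j in_levels (size b) c.
  by move/eqP; rewrite e mul0r eq_sym oner_eq0.
rewrite codedE (coded_restriction_mx in_levelsE) //.
rewrite (coded_restriction_mx in_levelsCE _ set_signC).
apply: minorn_split => r c rm cm; rewrite -/j.
- by move=> ne; rewrite (word_entry_off (P0 := in_levels)) // lev.
- move=> Pr Pc; rewrite (word_entry_diag (P0 := in_levels)) ?lev //; congr (_ * word_entry _ _ _).
  by apply: eq_rank => i ic; rewrite lev // (ltn_trans ic).
- move=> Pr Pc; rewrite (word_entry_diag (P0 := predC in_levels)) ?levC //; last first.
    by move=> i ib; rewrite mixedC; apply: zmix.
  rewrite strand_signC; congr (_ * word_entry _ _ _).
  by apply: eq_rank => i ic; rewrite levC // (ltn_trans ic).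
Qed.

Lemma BS_split z : mixed_vanish z ->
  BS z <-> BS (z *m restriction_mx b I set_sign) /\
    BS (z *m restriction_mx b (~: I) set_sign).
Proof.
move=> z0; rewrite !BS_minorn; split=> [nz|[nz1 nz2] m mn].
  split=> m mI.
    have [|i im <-] := @rank_onto in_levels n m; first by rewrite (rank_card in_levelsE).
    have [c _ e] := minorn_coded_split z0 im.
    by move: (nz i im); rewrite e !mulf_eq0 !negb_or => /and3P[].
  have [|i im <-] := @rank_onto (predC in_levels) n m.
    by rewrite (rank_card in_levelsCE).
  have [c _ e] := minorn_coded_split z0 im.
  by move: (nz i im); rewrite e !mulf_eq0 !negb_or => /and3P[].
have [c c0 ->] := minorn_coded_split z0 mn.
rewrite !mulf_neq0 //.
  by apply: nz1; rewrite -(rank_card in_levelsE) leq_rank.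
by apply: nz2; rewrite -(rank_card in_levelsCE) leq_rank.
Qed.

Lemma crossing_inC (k : 'I_(size b)) :
  crossing_in (~: I) k = (lower_strand k \notin I) && (upper_strand k \notin I).
Proof. by rewrite /crossing_in !in_setC. Qed.

Lemma mul_split_mxT (y : 'rV[K]_(_ + _)) :
  y *m split_mx^T =
  lsubmx y *m (restriction_mx b I set_sign)^T +
  rsubmx y *m (restriction_mx b (~: I) set_sign)^T.
Proof. by rewrite tr_row_mx -{1}[y]hsubmxK mul_row_col. Qed.

Lemma mixed_vanish_split_mxT (y : 'rV[K]_(_ + _)) : mixed_vanish (y *m split_mx^T).
Proof.
move=> k kmix; rewrite mul_split_mxT mxE !mul_restriction_mxT0 ?addr0 //.
  by rewrite crossing_inC; move: kmix; do 2!case: (_ \in _).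
by rewrite /crossing_in; move: kmix; do 2!case: (_ \in _).
Qed.

(** Each crossing lies in [I], in its complement, or is mixed. In the first two cases its sign is
    applied twice; in the last [z] is already zero. *)
Lemma split_mxK z : mixed_vanish z -> z *m split_mx *m split_mx^T = z.
Proof.
move=> z0; apply/rowP => k; rewrite mul_split_mxT mul_mx_row row_mxKl row_mxKr mxE.
have [/sub_crossingP[m ->]|kI] := boolP (crossing_in I k).
  rewrite mul_restriction_mxT mul_restriction_mx mulrA set_sign_sqr mul1r.
  rewrite mul_restriction_mxT0 ?addr0 // crossing_inC.
  have : crossing_in I (sub_crossing m) by apply/sub_crossingP; exists m.
  by case/andP => ->.
rewrite mul_restriction_mxT0 // add0r.
have [/sub_crossingP[m ->]|kC] := boolP (crossing_in (~: I) k).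
  by rewrite mul_restriction_mxT mul_restriction_mx mulrA set_sign_sqr mul1r.
rewrite mul_restriction_mxT0 // z0 //.
by move: kI kC; rewrite crossing_inC /crossing_in; do 2!case: (_ \in _).
Qed.

Lemma split_mxTK (y : 'rV[K]_(_ + _)) : y *m split_mx^T *m split_mx = y.
Proof.
rewrite mul_mx_row mul_split_mxT -[RHS]hsubmxK; congr row_mx; apply/rowP => m.
  rewrite mul_restriction_mx mxE mul_restriction_mxT mul_restriction_mxT0.
    by rewrite addr0 mulrA set_sign_sqr mul1r.
  have : crossing_in I (sub_crossing m) by apply/sub_crossingP; exists m.
  by rewrite crossing_inC; case/andP => ->.
rewrite mul_restriction_mx mxE mul_restriction_mxT mul_restriction_mxT0.
  by rewrite add0r mulrA set_sign_sqr mul1r.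
have : crossing_in (~: I) (sub_crossing m) by apply/sub_crossingP; exists m.
by rewrite crossing_inC /crossing_in => /andP[/negPf->].
Qed.

End Splitting.

(** * Linear maps as morphisms, and the fixed locus *)

Lemma regular_on_mulmx (K : fieldType) (a c : nat) (X : 'rV[K]_a -> Prop)
    (B : 'M[K]_(a, c)) (j : 'I_c) : regular_on X (fun x => (x *m B) 0 j).
Proof.
move=> x _; exists (\sum_k B k j *: 'X_k), 1, 1.
have ev1 (y : 'rV[K]_a) : peval 1 y = 1 by rewrite /peval meval1.
rewrite ev1 oner_eq0; split=> // y _ _; rewrite !ev1 oner_eq0; split=> //.
rewrite divr1 mxE /peval (raddf_sum (meval _)); apply: eq_bigr => k _ /=.
by rewrite mevalZ mevalXU mulrC.
Qed.

Lemma BS_fixedE (K : numFieldType) (n : nat) (b : braid_word n) (I : {set 'I_n})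
    (z : 'rV[K]_(size b)) :
  BS_fixed I (~: I) z <-> BS z /\ mixed_vanish I z.
Proof.
split=> -[zBS zI]; split=> //.
  (* At a mixed crossing this [t] scales [z 0 k] by 2 or by 1/2, which forces it to be zero. *)
  move=> k kmix; pose t : 'rV[K]_n := \row_i (if i \in I then 2 else 1).
  have tI : sub_torus I (~: I) t.
    split=> [i|i j]; first by rewrite mxE; case: ifP; rewrite ?pnatr_eq0 ?oner_eq0.
    by rewrite !mxE !in_setC; do 2!case: (_ \in _).
  have /rowP/(_ k) := zI t tI; rewrite !mxE.
  have two : (2 : K) != 0 by rewrite pnatr_eq0.
  case: (lower_strand k \in I) (upper_strand k \in I) kmix => [] [] // _ e.
    have : (2 / 1 - 1) * z 0 k = 0 by rewrite mulrBl e mul1r subrr.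
    by rewrite divr1 (_ : 2 - 1 = 1) ?mul1r //; ring.
  have : 2 * z 0 k - z 0 k = 0 by rewrite -{1}e; field.
  by move=> <-; ring.
move=> t [t0 tI]; apply/rowP => k; rewrite mxE.
have [kp|/zI->] := eqVneq (lower_strand k \in I) (upper_strand k \in I); last by rewrite mulr0.
rewrite (tI _ (upper_strand k)) ?divff ?mul1r //.
by rewrite !in_setC kp; case: (_ \in _).
Qed.

Theorem theorem6p4 (R : realType) (n : nat) (b : braid_word n)
    (b_full : forall i : 'I_n.-1, i \in b)
    (C1 C2 : {set {set 'I_n}})
    (C12_cover : C1 :|: C2 = components b)
    (C12_disjoint : [disjoint C1 & C2]) :
  let I1 := strands_of b C1 in
  let I2 := strands_of b C2 in
  isomorphic
    (fun z : 'rV[R[i]]_(size b) => BS_fixed I1 I2 z)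
    (variety_prod
       (fun z : 'rV[R[i]]_(size (sub_braid b I1)) => BS z)
       (fun z : 'rV[R[i]]_(size (sub_braid b I2)) => BS z)).
Proof.
move=> I1 I2.
have -> : I2 = ~: I1.
  apply/setP => k; rewrite !inE.
  have : porbit (braid_perm b) k \in C1 :|: C2.
    by rewrite C12_cover; apply: imset_f.
  rewrite inE; have [kC1 _|_ /= -> //] := boolP (_ \in C1).
  exact: (disjointFr C12_disjoint kC1).
(* At the right end [strand_at] is the inverse of [braid_perm b], which preserves every orbit. *)
have I1_stable l : (strand_at b (size b) l \in I1) = (l \in I1).
  rewrite !inE /strand_at take_size; congr (_ \in C1).
  by apply/eqP; rewrite eq_porbit_mem -porbitV; apply: (mem_porbit _ 1).
pose A := split_mx R[i] b I1.
exists (fun z => z *m A), (fun y => y *m A^T); split.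
- split=> [z /BS_fixedE[zBS z0]|j]; last exact: regular_on_mulmx.
  rewrite /variety_prod mul_mx_row row_mxKl row_mxKr.
  exact/(BS_split I1_stable).
- split=> [y [y1 y2]|j]; last exact: regular_on_mulmx.
  have y0 : mixed_vanish I1 (y *m A^T) := mixed_vanish_split_mxT y.
  have e := split_mxTK y; rewrite mul_mx_row in e.
  (* Writing [y] as the projection of its lift turns [y1] and [y2] into the two conditions of
     [BS_split]. *)
  rewrite -e row_mxKl in y1; rewrite -e row_mxKr in y2.
  by apply/BS_fixedE; split=> //; apply/(BS_split I1_stable y0).
- by move=> z /BS_fixedE[_ z0]; apply: split_mxK.
- by move=> y _; apply: split_mxTK.
Qed.
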